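(* Let $I_{\mathrm{MQ}}=S$ be an MQ instance where $S\subset\mathbb{F}[x_1,\dots,x_{3q}]$ is a standard-form system with $q\ge1$ quadratic equations, variables ordered so that the $i$-th quadratic equation is $x_{3i-2}x_{3i-1}+x_{3i}=0$. Let $\beta(S)=(H,s,t)$ and $\tau$ be as defined in the context. If $\widetilde v\in\mathbb{F}^{10q}$ is a solution of the MLD instance $\beta(I_{\mathrm{MQ}})$, i.e. $H\widetilde v^\top=s^\top$ and $\mathrm{w}(\widetilde v)\le t$, then $\tau(\widetilde v)\in\mathbb{F}^{3q}$ is a solution of $I_{\mathrm{MQ}}$, i.e. a common zero of all equations in $S$.
   Context: $\mathbb{F}=\mathbb{F}_2$; vectors are row vectors; $\mathrm{w}$ is the Hamming weight. A system is in standard form if it consists only of: equations of the form $xy+z=0$ ($x,y,z$ distinct variables), no two of which share a variable; and linear equations with at most three variables, of the form $x+\delta=0$, $x+y+\delta=0$ or $x+y+z+\delta=0$ with $\delta\in\mathbb{F}$; and each variable appearing in a linear equation appears in exactly one quadratic equation. Hence with $q$ quadratic equations it has exactly $3q$ variables. Let $\widehat C\subset\mathbb{F}^{10}$ be the code generated by the rows of $$\widehat G=\begin{bmatrix}1&0&0&1&1&0&0&1&1&1\\0&1&0&0&0&1&1&1&1&1\\0&0&1&1&1&1&1&1&1&1\end{bmatrix},$$ $\widehat\epsilon=(0,0,0,0,0,0,0,1,1,1)$, and $\widehat H\in\mathbb{F}^{7\times10}$ a parity-check matrix of $\widehat C$ (full rank, with null space $\widehat C$). Let $\widetilde H\in\mathbb{F}^{7q\times10q}$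 be the block-diagonal matrix with $q$ diagonal blocks $\widehat H$, $\widetilde\epsilon=(\widehat\epsilon\|\cdots\|\widehat\epsilon)\in\mathbb{F}^{10q}$ ($q$ copies, $\|$ is concatenation), $\widetilde s^\top=\widetilde H\widetilde\epsilon^\top$. Let $M_{\tau_3}$ be the $10\times3$ matrix whose top three rows form the identity and whose other rows are zero, $M_\tau\in\mathbb{F}^{10q\times3q}$ the block-diagonal matrix with $q$ blocks $M_{\tau_3}$, and $\tau:\mathbb{F}^{10q}\to\mathbb{F}^{3q}$, $\tau(v)=vM_\tau$. For a linear polynomial $f=\sum_{i=1}^{3q}a_ix_i+\delta$ put $a_f=(a_1,\dots,a_{3q})$ and $\nu(f)=a_fM_\tau^\top\in\mathbb{F}^{10q}$. If $f_1=0,\dots,f_\lambda=0$ are the linear equations of $S$ and $\delta_i=f_i(0)$, then $\beta(S)=(H,s,t)$ with $$H=\begin{bmatrix}\widetilde H\\\nu(f_1)\\\vdots\\\nu(f_\lambda)\end{bmatrix}\in\mathbb{F}^{(7q+\lambda)\times10q},\quad s=(\widetilde s\,\|\,\delta_1\|\cdots\|\delta_\lambda),\quad t=3q.$$ *)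

(* Defs.v *)
From mathcomp Require Import all_boot all_order all_algebra.
From mathcomp Require Import mxtens mpoly.
Set Implicit Arguments.
Unset Strict Implicit.
Unset Printing Implicit Defensive.
Import GRing.Theory.
Local Open Scope ring_scope.

Definition hweight n (v : 'rV['F_2]_n) : nat := #|[set i | v 0 i != 0]|.

Record mld_instance (n : nat) := MLD {
  mld_rows : nat;
  mld_mx : 'M['F_2]_(mld_rows, n);
  mld_syndrome : 'rV['F_2]_mld_rows;
  mld_bound : nat }.

Definition mld_solution n (I : mld_instance n) (v : 'rV['F_2]_n) : Prop :=
  mld_mx I *m v^T = (mld_syndrome I)^T /\ (hweight v <= mld_bound I)%N.

(* A finite set of polynomials is given by a duplicate-free list (see
   [standard_form]); the order of the list numbers the equations. *)
Definition mq_solution n (S : seq {mpoly 'F_2[n]}) (x : 'rV['F_2]_n) : Prop :=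
  forall f, f \in S -> f.@[x 0] = 0.

(* [msize] is the total degree plus one. *)
Definition quadratic_eqs n (S : seq {mpoly 'F_2[n]}) : seq {mpoly 'F_2[n]} :=
  [seq f <- S | msize f == 3].

Definition linear_eqs n (S : seq {mpoly 'F_2[n]}) : seq {mpoly 'F_2[n]} :=
  [seq f <- S | (msize f <= 2)%N].

Definition appears n (i : 'I_n) (f : {mpoly 'F_2[n]}) : bool :=
  has (fun m : 'X_{1..n} => m i != 0%N) (msupp f).

Definition standard_quadratic n (f : {mpoly 'F_2[n]}) : Prop :=
  exists x y z : 'I_n,
    [/\ x != y, x != z, y != z & f = 'X_x * 'X_y + 'X_z].

Definition standard_linear n (f : {mpoly 'F_2[n]}) : Prop :=
  exists (A : {set 'I_n}) (delta : 'F_2),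
    (0 < #|A| <= 3)%N /\ f = \sum_(i in A) 'X_i + delta%:MP.

Record standard_form n (S : seq {mpoly 'F_2[n]}) : Prop := StandardForm {
  sf_uniq : uniq S;
  sf_shape : forall f, f \in S -> standard_quadratic f \/ standard_linear f;
  sf_disjoint : forall f g, f \in quadratic_eqs S -> g \in quadratic_eqs S ->
    f != g -> forall i, ~~ (appears i f && appears i g);
  sf_linear_vars : forall f i, f \in linear_eqs S -> appears i f ->
    count (appears i) (quadratic_eqs S) = 1%N }.

(* The [k]-th variable ([k < 3]) of the [i]-th block; its index in
   ['I_(q * 3)] is [i * 3 + k], counting from 0. *)
Definition block_var q (i : 'I_q) (k : 'I_3) : 'I_(q * 3) :=
  mxtens_index (i, k).

Definition ordered_quadratics q (S : seq {mpoly 'F_2[q * 3]}) : Prop :=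
  size (quadratic_eqs S) = q /\
  forall i : 'I_q, nth 0 (quadratic_eqs S) i =
    'X_(block_var i 0) * 'X_(block_var i 1) + 'X_(block_var i 2%:R).

Definition Ghat_rows : seq (seq 'F_2) :=
  [:: [:: 1; 0; 0; 1; 1; 0; 0; 1; 1; 1];
      [:: 0; 1; 0; 0; 0; 1; 1; 1; 1; 1];
      [:: 0; 0; 1; 1; 1; 1; 1; 1; 1; 1]].

Definition Ghat : 'M['F_2]_(3, 10) :=
  \matrix_(i, j) nth 0 (nth [::] Ghat_rows i) j.

Definition epsilon_hat : 'rV['F_2]_10 :=
  \row_j nth 0 [:: 0; 0; 0; 0; 0; 0; 0; 1; 1; 1] j.

Definition parity_check k m n (G : 'M['F_2]_(k, n)) (H : 'M['F_2]_(m, n)) :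
  Prop :=
  row_free H /\ forall v : 'rV['F_2]_n, H *m v^T = 0 <-> (v <= G)%MS.

(* The block-diagonal matrix with [q] blocks [A] is the Kronecker product of
   the identity with [A]. *)
Definition block_diag q m n (A : 'M['F_2]_(m, n)) :
  'M['F_2]_(q * m, q * n) := 1%:M *t A.

Definition repeat_row q n (v : 'rV['F_2]_n) : 'rV['F_2]_(q * n) :=
  \row_j v 0 (mxtens_unindex j).2.

Definition M_tau3 : 'M['F_2]_(10, 3) := pid_mx 3.

Definition M_tau q : 'M['F_2]_(q * 10, q * 3) := block_diag q M_tau3.

Definition tau q (v : 'rV['F_2]_(q * 10)) : 'rV['F_2]_(q * 3) := v *m M_tau q.

Definition coef_row n (f : {mpoly 'F_2[n]}) : 'rV['F_2]_n := \row_i f@_U_(i).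

Definition const_term n (f : {mpoly 'F_2[n]}) : 'F_2 := f.@[fun=> 0].

Definition nu q (f : {mpoly 'F_2[q * 3]}) : 'rV['F_2]_(q * 10) :=
  coef_row f *m (M_tau q)^T.

Definition beta q (Hhat : 'M['F_2]_(7, 10)) (S : seq {mpoly 'F_2[q * 3]}) :
  mld_instance (q * 10) :=
  let L := linear_eqs S in
  let Htilde := block_diag q Hhat in
  let stilde := (Htilde *m (repeat_row q epsilon_hat)^T)^T in
  MLD (col_mx Htilde (\matrix_(j < size L) nu L`_j))
      (row_mx stilde (\row_(j < size L) const_term L`_j))
      (3 * q).

(* Main.v *)
Require Import Defs.
From mathcomp Require Import all_boot all_order all_algebra.
From mathcomp Require Import mxtens mpoly.
Set Implicit Arguments.
Unset Strict Implicit.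
Unset Printing Implicit Defensive.
Import GRing.Theory.
Local Open Scope ring_scope.

(** Each length-10 block of a solution lies in the coset [epsilon_hat + Chat].
    The eight words of this coset are indexed by [(x, y, z)], their first three
    coordinates; they have weight 3 when [x * y + z = 0] and weight at least 5
    otherwise.  The bound [3 * q] on the total weight thus forces every block
    to have weight exactly 3, which is the quadratic equation of that block.
    The linear equations are literally the last rows of the parity checks. *)

Lemma big_mxtens_index (R : Type) (idx : R) (op : Monoid.com_law idx) (m n : nat)
    (F : 'I_(m * n) -> R) :
  \big[op/idx]_(k < m * n) F k =
  \big[op/idx]_(i < m) \big[op/idx]_(j < n) F (mxtens_index (i, j)).
Proof.
rewrite pair_big (reindex (@mxtens_index m n)) /=; first by apply: eq_bigr => -[].
by exists (@mxtens_unindex m n) => k _; rewrite (mxtens_indexK, mxtens_unindexK).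
Qed.

Definition row_block (R : Type) q n (v : 'rV[R]_(q * n)) (i : 'I_q) : 'rV[R]_n :=
  \row_j v 0 (mxtens_index (i, j)).

Lemma mul_block_diag q m n (A : 'M['F_2]_(m, n)) (v : 'rV['F_2]_(q * m)) i :
  row_block (v *m block_diag q A) i = row_block v i *m A.
Proof.
apply/rowP => k; rewrite !mxE big_mxtens_index (bigD1 i) //= [X in _ + X]big1 => [|j ji].
  by rewrite addr0; apply: eq_bigr => l _; rewrite tensmxE !mxE eqxx mul1r.
by apply: big1 => l _; rewrite tensmxE mxE (negPf ji) mul0r mulr0.
Qed.

Lemma block_diag_tr q m n (A : 'M['F_2]_(m, n)) :
  (block_diag q A)^T = block_diag q A^T.
Proof. by rewrite /block_diag trmx_tens trmx1. Qed.

Lemma hweight_sum n (v : 'rV['F_2]_n) : hweight v = (\sum_i (v 0 i != 0)%R)%N.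
Proof. by rewrite /hweight cardsE -sum1_card big_mkcond. Qed.

Lemma hweight_row_block q n (v : 'rV['F_2]_(q * n)) :
  hweight v = (\sum_i hweight (row_block v i))%N.
Proof.
rewrite hweight_sum big_mxtens_index; apply: eq_bigr => i _.
by rewrite hweight_sum; apply: eq_bigr => j _; rewrite mxE.
Qed.

Lemma F2P (x : 'F_2) : x = 0 \/ x = 1.
Proof. by case: x => -[|[|//]] ?; [left | right]; apply: val_inj. Qed.

(** The first three columns of [Ghat] form the identity and [epsilon_hat] vanishes there, so the
    prefix of a coset word is its message [u]. *)
Lemma coset_prefix (u : 'rV['F_2]_3) (k : 'I_3) :
  ((epsilon_hat + u *m Ghat) *m M_tau3) 0 k = u 0 k.
Proof.
rewrite !mxE !big_ord_recl big_ord0 !mxE !big_ord_recl !big_ord0 !mxE /=.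
case: k => -[|[|[|//]]] lt_k3 /=;
  rewrite !(mulr0, mulr1, addr0, add0r); congr (u 0 _); exact: val_inj.
Qed.

(** With [u = (x, y, z)] the word consists of [x], [y], [z], twice [x + z], twice [y + z] and three
    times [x + y + z + 1]; the eight cases are checked by evaluation. *)
Lemma hweight_coset (u : 'rV['F_2]_3) :
  (3 <= hweight (epsilon_hat + u *m Ghat))%N /\
  (hweight (epsilon_hat + u *m Ghat) = 3 -> u 0 0 * u 0 1 + u 0 2%:R = 0).
Proof.
set w := hweight _.
suff /andP[le3w /implyP w3] :
    (3 <= w)%N && ((w == 3) ==> (u 0 0 * u 0 1 + u 0 2%:R == 0)).
  by split=> // /eqP /w3 /eqP.
rewrite /w hweight_sum !big_ord_recl big_ord0 !mxE !big_ord_recl !big_ord0 !mxE /=.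
have -> : lift ord0 ord0 = 1 :> 'I_3 by exact: val_inj.
have -> : lift ord0 (lift ord0 ord0) = 2%:R :> 'I_3 by exact: val_inj.
rewrite -[ord0]/(0 : 'I_3).
by case: (F2P (u 0 0)) => ->; case: (F2P (u 0 1)) => ->;
   case: (F2P (u 0 2%:R)) => ->; vm_compute.
Qed.

Lemma eq_sum_of_leq (I : finType) (F : I -> nat) (c : nat) :
    (forall i, (c <= F i)%N) -> (\sum_i F i <= c * #|I|)%N ->
  forall i, F i = c.
Proof.
move=> leF sumF i; apply/eqP; rewrite eq_sym.
(* A sum of termwise inequalities is an equality only if every term is. *)
have [_] := leqif_sum (fun j (_ : true) => leqif_eq (leF j)).
rewrite sum_nat_const mulnC eqn_leq sumF andbT => allF.
have: (c * #|I| <= \sum_j F j)%N by rewrite mulnC -sum_nat_const leq_sum.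
by rewrite allF => /forallP /(_ i).
Qed.

(** Needed to match the shape of an equation with the degree filter in [quadratic_eqs]. *)
Lemma standard_quadratic_msize n (f : {mpoly 'F_2[n]}) :
  standard_quadratic f -> msize f = 3.
Proof.
case=> x [y [z [_ _ _ ->]]]; apply/eqP; rewrite eqn_leq; apply/andP; split.
  by rewrite (leq_trans (msizeD_le _ _)) // -mpolyXD !msizeX mdegD !mdeg1.
rewrite ltnNge; apply/negP => le2.
(* Otherwise the monomial of ['X_x * 'X_y] would lie outside the support; but its coefficient is 1,
   since ['X_z] has degree 1 and cannot cancel it. *)
have /msize_mdeg_ge : (msize ('X_x * 'X_y + 'X_z : {mpoly 'F_2[n]})
    <= mdeg (U_(x) + U_(y))%MM)%N by rewrite mdegD !mdeg1.
rewrite mcoeff_msupp mcoeffD -mpolyXD !mcoeffX eqxx negbK.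
case: (U_(z)%MM =P _) => [/(congr1 (@mdeg n))|_]; first by rewrite mdegD !mdeg1.
by rewrite addr0 oner_eq0.
Qed.

Lemma standard_linear_msize n (f : {mpoly 'F_2[n]}) :
  standard_linear f -> (msize f <= 2)%N.
Proof.
case=> A [d [_ ->]]; rewrite (leq_trans (msizeD_le _ _)) // geq_max msizeC.
rewrite (leq_trans (leq_b1 _)) // andbT (leq_trans (msize_sum _ _ _)) //.
by apply/bigmax_leqP => i _; rewrite msizeX mdeg1.
Qed.

(** Links the value of [f] to the two data that [beta] extracts from it. *)
Lemma standard_linear_meval n (f : {mpoly 'F_2[n]}) (x : 'rV['F_2]_n) :
  standard_linear f -> f.@[x 0] = (coef_row f *m x^T) 0 0 + const_term f.
Proof.
case=> A [d [_ ->]].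
rewrite /const_term !mevalD !mevalC !raddf_sum /= [X in _ + (X + _)]big1 => [|i _];
  last by rewrite mevalXU.
rewrite add0r mxE big_mkcond; congr (_ + _); apply: eq_bigr => i _.
rewrite !mxE mcoeffD mcoeffC raddf_sum /= mnm1_eq0 mulr0 addr0.
case: ifP => Ai.
  rewrite mevalXU (bigD1 i) //= mcoeffXU eqxx big1 ?addr0 ?mul1r // => j /andP[_ /negPf ji].
  by rewrite mcoeffXU ji.
rewrite big1 ?mul0r // => j Aj; rewrite mcoeffXU.
by case: eqP Aj => // ->; rewrite Ai.
Qed.

Theorem theorem4p16 (q : nat) (hq : (0 < q)%N)
    (Hhat : 'M['F_2]_(7, 10)) (hHhat : parity_check Ghat Hhat)
    (S : seq {mpoly 'F_2[q * 3]}) (hS : standard_form S)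
    (hord : ordered_quadratics S)
    (v : 'rV['F_2]_(q * 10)) (hv : mld_solution (beta Hhat S) v) :
  mq_solution S (tau v).
Proof.
case: hv => /= + le_w; rewrite mul_col_mx tr_row_mx trmxK => /eq_col_mx[hH hL].
have coset i : exists u, row_block v i = epsilon_hat + u *m Ghat.
  suff /submxP[u uE] : (row_block v i - epsilon_hat <= Ghat)%MS.
    by exists u; rewrite -uE addrC subrK.
  (* Membership in the code is tested by the syndrome: block [i] of [v] and [epsilon_hat] have the
     same one, by block [i] of [hH]. *)
  apply/hHhat.2; apply: trmx_inj; rewrite trmx_mul trmxK trmx0 mulmxBl.
  have -> : epsilon_hat = row_block (repeat_row q epsilon_hat) i.
    by apply/rowP => k; rewrite !mxE mxtens_indexK.
  rewrite -!mul_block_diag -block_diag_tr.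
  have := congr1 trmx hH; rewrite !trmx_mul !trmxK => ->.
  by rewrite subrr.
have block_w : forall i, hweight (row_block v i) = 3.
  apply: eq_sum_of_leq => [i|]; last by rewrite -hweight_row_block card_ord.
  by have [u ->] := coset i; have [] := hweight_coset u.
move=> f Sf; case: (sf_shape hS Sf) => [fQ|fL].
  have {}Sf : f \in quadratic_eqs S by rewrite mem_filter Sf standard_quadratic_msize.
  (* The block belonging to [f] is given by the position of [f] among the quadratic equations. *)
  have lt_fq : (index f (quadratic_eqs S) < q)%N.
    by rewrite -[X in (_ < X)%N]hord.1 index_mem.
  rewrite -(nth_index 0 Sf) (hord.2 (Ordinal lt_fq)); set i := Ordinal lt_fq.
  have [u uE] := coset i.
  have tauE k : tau v 0 (block_var i k) = u 0 k.
    have := mul_block_diag M_tau3 v i; rewrite uE => /rowP/(_ k).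
    by rewrite coset_prefix mxE.
  rewrite mevalD mevalM !mevalXU !tauE.
  by apply: (hweight_coset u).2; rewrite -uE.
have {}Sf : f \in linear_eqs S by rewrite mem_filter Sf standard_linear_msize.
have lt_fL : (index f (linear_eqs S) < size (linear_eqs S))%N by rewrite index_mem.
(* The parity check contributed by [f] equates [nu f *m v^T] with the constant term of [f]. *)
have /colP/(_ (Ordinal lt_fL)) := hL.
rewrite !mxE /= nth_index // standard_linear_meval // => <-.
have -> : coef_row f *m (tau v)^T = nu f *m v^T.
  by rewrite /tau /nu trmx_mul mulmxA.
rewrite [X in X + _]mxE.
under [X in _ + X]eq_bigr => j _ do rewrite !mxE /= nth_index //.
under [X in X + _]eq_bigr => j _ do rewrite !mxE.
(* The value of [f] has become a sum of two equal terms, zero in characteristic 2. *)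
by rewrite -mulr2n -mulr_natl pchar_Zp // mul0r.
Qed.
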